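(* The proof systems $\mathsf{QCDCL}^{\textsf{LEV-ORD}}_{\textsf{NO-RED}}$ and $\mathsf{QCDCL}^{\textsf{LEV-ORD}}_{\textsf{RED}}$ are incomparable, i.e., neither of them simulates the other: there are false QCNFs with polynomial-size refutations in one of the systems that require super-polynomial-size refutations in the other, in both directions.
   Context: QBF basics. A literal is a variable $x$ or $\bar x$; a clause is a disjunction of literals identified with its set of literals; $(\bot)$ is the empty clause. A QCNF is $\Phi=\mathcal{Q}\cdot\phi$ with prefix $\mathcal{Q}=Q_1X_1\dots Q_sX_s$ (disjoint nonempty variable sets, alternating $Q_i\in\{\exists,\forall\}$) and matrix $\phi$ a CNF of non-tautological clauses. $\mathrm{lv}(x)=i$ if the variable of $x$ is in $X_i$; existential/universal variables are those in $\exists$/$\forall$-blocks. $\mathrm{red}(C)$ deletes from $C$ every universal literal $v$ with $\mathrm{lv}(v)>\mathrm{lv}(x)$ for all existential $x\in C$. For existential $\ell$ not occurring (as variable) in $C_1,C_2$: $(C_1\vee\ell)\otimes_\ell(C_2\vee\bar\ell)=C_1\vee C_2$. QCDCL. $C|_\sigma=\top$ if $C\cap\sigma\neq\emptyset$, else the clause of all $\ell\in C$ with $\bar\ell\notin\sigma$. A trail for $\Phi=\mathcal{Q}\cdot\phi$ is $\mathcal{T}=(p_{(0,1)},\dots,p_{(0,g_0)};d_1,p_{(1,1)},\dots,p_{(1,g_1)};\dots;d_r,p_{(r,1)},\dots,p_{(r,g_r)})$, a sequence of literals with no variable occurring twice; $d_i$ decision literals, $p_{(i,j)}$ propagated literals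 (existential, or $\bot$ only as last element: a conflict). $\mathcal{T}[s,t]$: initial segment ending at $p_{(s,t)}$ (at $d_s$ if $t=0$; $\mathcal{T}[0,0]$ empty); $|\mathcal{T}|$: number of elements. Each $p_{(i,j)}$ has an antecedent $\mathrm{ante}(p_{(i,j)})\in\phi$ with: under RED, $\mathrm{red}(\mathrm{ante}(p_{(i,j)})|_{\mathcal{T}[i,j-1]})=(p_{(i,j)})$; under NO-RED, $\mathrm{ante}(p_{(i,j)})|_{\mathcal{T}[i,j-1]}=(p_{(i,j)})$ ($(\bot)$ = empty clause). Decision policy LEV-ORD: $\mathrm{lv}(d_i)\le\mathrm{lv}(x)$ for all variables $x$ of $\phi$ unassigned in $\mathcal{T}[i-1,g_{i-1}]$. A clause $C$ is unit under RED if $\mathrm{red}(C)=(x)$, $x$ existential, or $\mathrm{red}(C)$ empty ($x=\bot$); under NO-RED if $C=(x)$, $x$ existential, or $C$ empty. Natural condition at an initial segment without $\bot$: if some clauses of the current clause set are unit under it, the next element is the literal of one of them with that clause as antecedent, and is $\bot$ if possible; natural trail: holds everywhere. Learnable clauses of a trail ending in $\bot$: $C_{(r,g_r)}=\mathrm{red}(\mathrm{ante}(\bot))$; leftwards over propagated $p$, with $C'$ the clause of the next propagated literal to the right, the clause of $p$ is $\mathrm{red}(C'\otimes_p\mathrm{red}(\mathrm{ante}(p)))$ if $\bar p\in C'$, else $C'$; $\mathcal{L}_\mathcal{T}$ is this sequence. A $\mathsf{QCDCL}^{\textsf{LEV-ORD}}_{R}$ proof of $C$ from $\Phi$ is $((\mathcal{T}_1,\dots,\mathcal{T}_m),(C_1,\dots,C_m),(\pi_1,\dots,\pi_m))$: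 each $\mathcal{T}_i$ a trail following LEV-ORD and $R$ for $\mathcal{Q}\cdot(\phi\cup\{C_1,\dots,C_{i-1}\})$ that has run into a conflict, $C_i\in\mathcal{L}_{\mathcal{T}_i}$ with its derivation $\pi_i$, $C_m=C$, $\mathcal{T}_1$ natural, and for $i\ge2$ some $(s,t)$ with $\mathcal{T}_i[s,t]=\mathcal{T}_{i-1}[s,t]$ such that $\mathcal{T}_i$ satisfies the natural condition at all initial segments extending $\mathcal{T}_i[s,t]$. Refutation if $C=(\bot)$; size $\sum_i|\mathcal{T}_i|$. A system $g$ simulates $f$ if every $f$-proof can be transformed into a $g$-proof of the same formula of polynomially related size. *)

(* Defs.v *)
From mathcomp Require Export all_boot all_order all_algebra.
From mathcomp Require Export finmap.

Set Implicit Arguments.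
Unset Strict Implicit.
Unset Printing Implicit Defensive.

Local Open Scope fset_scope.

(* (x, true) is the literal x and (x, false) its negation. *)
Definition lit : Type := (nat * bool)%type.
Definition neg (l : lit) : lit := (l.1, ~~ l.2).

Definition clause : Type := {fset lit}.
Definition cnf : Type := {fset clause}.

Inductive quantifier := QEx | QAll.
Definition is_ex (q : quantifier) : bool := if q is QEx then true else false.

Definition block : Type := (quantifier * {fset nat})%type.
Definition prefix_of_blocks : Type := seq block.

Definition tautological (C : clause) : bool :=
  has (fun l => neg l \in C) (enum_fset C).

Record qcnf := QCNF {
  qprefix : prefix_of_blocks;
  qmatrix : cnf;
  qprefix_nonempty : all (fun B : block => B.2 != fset0) qprefix;
  qprefix_disjoint :
    pairwise (fun B B' : block => [disjoint B.2 & B'.2]) qprefix;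
  qprefix_alternating :
    sorted (fun B B' : block => is_ex B.1 != is_ex B'.1) qprefix;
  qmatrix_closed : forall (C : clause) (l : lit),
    C \in qmatrix -> l \in C -> has (fun B : block => l.1 \in B.2) qprefix;
  qmatrix_nontaut : forall C : clause, C \in qmatrix -> ~~ tautological C
}.

Definition qcnf_size (Phi : qcnf) : nat :=
  \sum_(B <- qprefix Phi) #|` B.2| + \sum_(C <- qmatrix Phi) (#|` C|).+1.

Fixpoint qtrue_under (Q : prefix_of_blocks) (phi : cnf) (s : nat -> bool) :
    Prop :=
  match Q with
  | [::] => forall C : clause, C \in phi -> exists2 l : lit, l \in C & s l.1 = l.2
  | (QEx, X) :: Q' =>
      exists t, (forall x, x \notin X -> t x = s x) /\ qtrue_under Q' phi t
  | (QAll, X) :: Q' =>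
      forall t, (forall x, x \notin X -> t x = s x) -> qtrue_under Q' phi t
  end.

(* The initial valuation is irrelevant, since the formula is closed. *)
Definition qtrue (Phi : qcnf) : Prop :=
  qtrue_under (qprefix Phi) (qmatrix Phi) (fun _ => false).

Definition qfalse (Phi : qcnf) : Prop := ~ qtrue Phi.

Section Prefix.
Variable Q : prefix_of_blocks.

Definition bound (x : nat) : bool := has (fun B : block => x \in B.2) Q.
Definition lv (x : nat) : nat := (find (fun B : block => x \in B.2) Q).+1.
Definition existential (x : nat) : bool :=
  has (fun B : block => is_ex B.1 && (x \in B.2)) Q.
Definition universal (x : nat) : bool :=
  has (fun B : block => ~~ is_ex B.1 && (x \in B.2)) Q.

Definition red (C : clause) : clause :=
  [fset v in C | ~~ (universal v.1 &&
     all (fun x : lit => existential x.1 ==> (lv x.1 < lv v.1)) (enum_fset C))].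

(* [resolve p C D] is the resolvent of C (containing the negation of p) with
   D (containing p). *)
Definition resolve (p : lit) (C D : clause) : clause :=
  (C `\ neg p) `|` (D `\ p).

(* [None] stands for the satisfied clause (top). *)
Definition restrict (C : clause) (sigma : seq lit) : option clause :=
  if has (fun l => l \in sigma) (enum_fset C) then None
  else Some [fset l in C | neg l \notin sigma].

Inductive reduction_policy := RED | NO_RED.

(* A propagated element is a literal or bottom, the latter being [None]. *)
Definition clause_of_element (p : option lit) : clause :=
  if p is Some l then [fset l] else fset0.

Definition unit_clause (R : reduction_policy) (C : clause) (p : option lit) :
    Prop :=
  (if R is RED then red C else C) = clause_of_element p /\
  (forall l, p = Some l -> existential l.1).

Definition unit_under (R : reduction_policy) (C : clause) (sigma : seq lit)
    (p : option lit) : Prop :=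
  exists2 D, restrict C sigma = Some D & unit_clause R D p.

(* A trail is stored as its sequence of elements, each one marked as a decision
   or as a propagation, the latter together with its antecedent.  The initial
   segments T[s, t] are exactly the [take k T] with [k <= size T]. *)
Inductive step :=
| Decide of lit
| Propagate of option lit & clause.

Definition trail : Type := seq step.

(* [(true, l)] is a decision, [(false, p)] a propagation; the antecedents are
   forgotten. *)
Definition step_element (e : step) : bool * option lit :=
  match e with
  | Decide l => (true, Some l)
  | Propagate p _ => (false, p)
  end.

Definition elements (T : trail) : seq (bool * option lit) := map step_element T.

Definition assignment (T : trail) : seq lit :=
  pmap (fun e => (step_element e).2) T.

Definition assigned (T : trail) : seq nat := [seq l.1 | l <- assignment T].

Definition conflict_in (T : trail) : bool := (false, None) \in elements T.

Definition conflicting (T : trail) : Prop :=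
  exists T' A, T = rcons T' (Propagate None A).

Definition lev_ord (phi : cnf) (T : trail) (d : lit) : Prop :=
  forall (C : clause) (l : lit), C \in phi -> l \in C ->
    l.1 \notin assigned T -> lv d.1 <= lv l.1.

Definition is_trail (R : reduction_policy) (phi : cnf) (T : trail) : Prop :=
  [/\ uniq (assigned T),
      forall k d, onth T k = Some (Decide d) ->
        bound d.1 /\ lev_ord phi (take k T) d,
      forall k p A, onth T k = Some (Propagate p A) ->
        A \in phi /\ unit_under R A (assignment (take k T)) p
    & forall k A, onth T k = Some (Propagate None A) -> k.+1 = size T].

Definition natural_at (R : reduction_policy) (phi : cnf) (T : trail) (k : nat) :
    Prop :=
  let sigma := assignment (take k T) in
  ~~ conflict_in (take k T) ->
  (exists C p, C \in phi /\ unit_under R C sigma p) ->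
  exists p A,
    [/\ onth T k = Some (Propagate p A), A \in phi, unit_under R A sigma p
      & (exists2 C, C \in phi & unit_under R C sigma None) -> p = None].

Definition natural_from (R : reduction_policy) (phi : cnf) (T : trail)
    (k : nat) : Prop :=
  forall j, k <= j <= size T -> natural_at R phi T j.

(* [T] is read from right to left and [C] is the clause of the propagated
   element just passed. *)
Fixpoint learn_leftwards (C : clause) (T : trail) : seq clause :=
  match T with
  | Propagate (Some p) A :: T' =>
      let C' := if neg p \in C then red (resolve p C (red A)) else C in
      C' :: learn_leftwards C' T'
  | _ :: T' => learn_leftwards C T'
  | [::] => [::]
  end.

Definition learnable (T : trail) : seq clause :=
  match rev T with
  | Propagate None A :: T' => red A :: learn_leftwards (red A) T'
  | _ => [::]
  end.

End Prefix.

(* The derivation of a learned clause is the initial part, ending in that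
   clause, of the sequence of learnable clauses. *)
Record round := Round {
  round_trail : trail;
  round_clause : clause;
  round_deriv : seq clause
}.

Definition learned (rs : seq round) : cnf :=
  [fset C in [seq round_clause r | r <- rs]].

Definition valid_round (R : reduction_policy) (Q : prefix_of_blocks) (phi : cnf)
    (previous : option round) (r : round) : Prop :=
  let T := round_trail r in
  [/\ is_trail Q R phi T,
      conflicting T,
      prefix (round_deriv r) (learnable Q T) /\
        (exists D, round_deriv r = rcons D (round_clause r))
    & if previous is Some r' then
        exists k, [/\ k <= size T, k <= size (round_trail r'),
          elements (take k T) = elements (take k (round_trail r'))
          & natural_from Q R phi T k]
      else natural_from Q R phi T 0].

(* QCDCL with decision policy LEV-ORD and reduction policy [R]. *)
Definition qcdcl_proof (R : reduction_policy) (Phi : qcnf) (C : clause)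
    (P : seq round) : Prop :=
  (forall i r, onth P i = Some r ->
     valid_round R (qprefix Phi) (qmatrix Phi `|` learned (take i P))
       (if i is j.+1 then onth P j else None) r) /\
  (exists P' r, P = rcons P' r /\ round_clause r = C).

Definition qcdcl_refutation (R : reduction_policy) (Phi : qcnf)
    (P : seq round) : Prop := qcdcl_proof R Phi fset0 P.

Definition proof_size (P : seq round) : nat :=
  \sum_(r <- P) size (round_trail r).

(* The system with policy [R'] simulates the system with policy [R]. *)
Definition simulates (R' R : reduction_policy) : Prop :=
  exists p : {poly nat}, forall (Phi : qcnf) (P : seq round),
    qcdcl_refutation R Phi P ->
    exists2 P', qcdcl_refutation R' Phi P' &
      proof_size P' <= horner p (proof_size P).

Definition poly_size_refutations (R : reduction_policy) (Phi : nat -> qcnf) :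
    Prop :=
  exists p : {poly nat}, forall n, exists2 P, qcdcl_refutation R (Phi n) P &
    proof_size P <= horner p (qcnf_size (Phi n)).

Definition superpoly_size_refutations (R : reduction_policy)
    (Phi : nat -> qcnf) : Prop :=
  forall q : {poly nat}, exists N, forall n, N <= n ->
    forall P, qcdcl_refutation R (Phi n) P ->
      horner q (qcnf_size (Phi n)) < proof_size P.

(* Main.v *)
Require Import Defs.
From mathcomp Require Import zify.

(** Both separations use the prefix ∃x_1..x_m ∀u ∃a_1..a_m ∀w ∃t and the core
    clauses (±x_i ∨ ±u ∨ a_i), (±u ∨ ¬a_1 ∨ .. ∨ ¬a_m), next to clauses in w and
    t alone that are trivial to refute but are only reached once w is decided.

    Adding ¬w to the core clauses and taking the clauses (w ∨ t), (w ∨ ¬t) gives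
    the formulas that are easy without reduction: the literal ¬w blocks every
    propagation, so one may decide everything up to w = 0 and learn the empty
    clause at once.  Under reduction ¬w is dropped, and some core clause is
    falsified before w can be decided.  Taking the core clauses as they are
    together with (w) gives the formulas that are easy under reduction, since
    (w) reduces to the empty clause, whereas without reduction w is again never
    reached.

    In the hard direction a trail assigns all of x before u and the a_i, so
    conflict analysis resolves over the a_i first.  As long as only the a_i have
    been resolved, a clause free of them mentions every x_i and hence excludes
    one assignment of x only.  Each trail contributes at most one such clause,
    and the empty clause excludes all 2^m assignments. *)

Set Implicit Arguments.
Unset Strict Implicit.
Unset Printing Implicit Defensive.

Local Open Scope fset_scope.
Local Open Scope nat_scope.

Local Notation vars sigma := [seq l.1 | l <- sigma].

Lemma onth_take (S : Type) (s : seq S) k i :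
  i < k -> onth (take k s) i = onth s i.
Proof. by move=> ik; rewrite !onthE map_take nth_take. Qed.

Lemma onth_cat_cons (S : Type) (s s' : seq S) x :
  onth (s ++ x :: s') (size s) = Some x.
Proof. by rewrite onth_cat ltnn subnn. Qed.

Lemma onth_rcons (S : Type) (s : seq S) x k :
  onth (rcons s x) k = if k == size s then Some x else onth s k.
Proof.
rewrite -cats1 onth_cat; case: ltngtP => [//|sk|->]; last by rewrite subnn.
by rewrite !onth_default //= ?(ltnW sk) // subn_gt0.
Qed.

Lemma cat_take_onth (S : Type) (s : seq S) k x :
  onth s k = Some x -> s = take k s ++ x :: drop k.+1 s.
Proof.
move=> sk; have ks : k < size s by rewrite -onthTE sk.
by rewrite -{1}(cat_take_drop k s) (drop_nth x ks) (onth_nth x x s k sk).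
Qed.

(** * Clauses, reduction and restriction *)

Lemma negK : involutive neg.
Proof. by case=> x b; rewrite /neg /= negbK. Qed.

Lemma mem_var (sigma : seq lit) (l : lit) : l \in sigma -> l.1 \in vars sigma.
Proof. exact: map_f. Qed.

Lemma notin_vars (sigma : seq lit) (l : lit) :
  l.1 \notin vars sigma -> l \notin sigma /\ neg l \notin sigma.
Proof. by move=> ls; split; apply: contra ls => /mem_var. Qed.

Lemma eq_var (l q : lit) : l.1 = q.1 -> l = q \/ l = neg q.
Proof. by case: l q => x [] [y []] /= ->; auto. Qed.

Lemma neg_notin (sigma : seq lit) (l : lit) :
  uniq (vars sigma) -> l \in sigma -> neg l \notin sigma.
Proof.
elim: sigma => //= k s IH /andP[ks us]; rewrite !inE negb_or.
case/predU1P=> [-> | ls].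
  rewrite (contra (@mem_var s (neg k)) ks) andbT.
  by apply/eqP => /(congr1 snd) /=; case: (k.2).
by rewrite IH // andbT; apply: contraNneq ks => <-; apply: (mem_var ls).
Qed.

Lemma lit_value (sigma : seq lit) (l : lit) :
  uniq (vars sigma) -> l \in sigma -> ((l.1, true) \in sigma) = l.2.
Proof. by case: l => x [] // us /(neg_notin us) /negbTE. Qed.

Lemma assigned_falsified (sigma : seq lit) x :
  x \in vars sigma -> exists b, neg (x, b) \in sigma.
Proof. by case/mapP=> -[y b] yb ->; exists (~~ b); rewrite /neg /= negbK. Qed.

Lemma not_tautological (s : nat -> bool) (C : clause) :
  (forall l : lit, l \in C -> l.2 = s l.1) -> ~~ tautological C.
Proof.
move=> sC; apply/hasPn => l lC; apply/negP => /sC /=; rewrite -(sC l lC).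
by case: (l.2).
Qed.

Definition hits (S : pred lit) (C : clause) : bool := has S (enum_fset C).

Lemma hitsP (S : pred lit) (C : clause) :
  reflect (exists2 l : lit, l \in C & S l) (hits S C).
Proof. exact: hasP. Qed.

Lemma in_resolve p C D (l : lit) : (l \in resolve p C D) =
  (l != neg p) && (l \in C) || (l != p) && (l \in D).
Proof. by rewrite !inE. Qed.

Lemma hits_resolve (S : pred lit) p C D :
  ~~ (S p && S (neg p)) -> hits S C -> hits S D -> hits S (resolve p C D).
Proof.
move=> Sp /hitsP[k kC Sk] /hitsP[l lD Sl]; apply/hitsP.
have [kp|kp] := eqVneq k (neg p); last by exists k; rewrite // in_resolve kp kC.
have [lp|lp] := eqVneq l p; first by move: Sp; rewrite -kp -lp Sk Sl.
by exists l; rewrite // in_resolve lp lD orbT.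
Qed.

Lemma resolve_complementary p (C : clause) :
  p \notin C -> neg p \notin C -> resolve p (neg p |` C) (p |` C) = C.
Proof. by move=> pC npC; rewrite /resolve !fsetU1K // fsetUid. Qed.

Section Reduction.

Variable Q : prefix_of_blocks.
Implicit Types (C D g : clause) (l q : lit).

Lemma in_red C l : (l \in red Q C) = (l \in C) && ~~ (universal Q l.1 &&
  all (fun q => existential Q q.1 ==> (lv Q q.1 < lv Q l.1)) (enum_fset C)).
Proof. by rewrite !inE. Qed.

Lemma red_sub C : {subset red Q C <= C}.
Proof. by move=> l; rewrite in_red => /andP[]. Qed.

Lemma mem_red_nonuniversal C l : l \in C -> ~~ universal Q l.1 -> l \in red Q C.
Proof. by move=> lC /negPf lU; rewrite in_red lC lU. Qed.

Lemma mem_red_blocked C l q : l \in C -> q \in C -> existential Q q.1 ->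
  lv Q l.1 <= lv Q q.1 -> l \in red Q C.
Proof.
move=> lC qC qE lq; rewrite in_red lC /=.
by apply/negP => /andP[_ /allP/(_ _ qC)]; rewrite qE /= ltnNge lq.
Qed.

Lemma notin_red_trailing C l : universal Q l.1 ->
  (forall q, q \in C -> existential Q q.1 -> lv Q q.1 < lv Q l.1) ->
  l \notin red Q C.
Proof.
move=> lU ltl; rewrite in_red lU /= negb_and negbK; apply/orP; right.
by apply/allP => q qC; apply/implyP; apply: ltl.
Qed.

Lemma red_nonuniversal_id C :
  (forall l, l \in C -> ~~ universal Q l.1) -> red Q C = C.
Proof.
move=> CE; apply/fsetP => l; apply/idP/idP => [/red_sub //|lC].
by apply: mem_red_nonuniversal => //; apply: CE.
Qed.

Lemma red_blocked_id C q : q \in C -> existential Q q.1 ->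
  (forall l, l \in C -> lv Q l.1 <= lv Q q.1) -> red Q C = C.
Proof.
move=> qC qE leq; apply/fsetP => l; apply/idP/idP => [/red_sub //|lC].
by apply: mem_red_blocked qE (leq l lC).
Qed.

Lemma red_fsetU_trailing D g : (forall l, l \in D -> ~~ universal Q l.1) ->
  (forall l, l \in g -> universal Q l.1 /\
     forall q, q \in D `|` g -> existential Q q.1 -> lv Q q.1 < lv Q l.1) ->
  red Q (D `|` g) = D.
Proof.
move=> DE gU; apply/fsetP => l; apply/idP/idP => [lr | lD]; last first.
  by apply: mem_red_nonuniversal; [rewrite inE lD | apply: DE].
have := red_sub lr; rewrite inE => /orP[//|/gU[lU ltl]].
by have := notin_red_trailing lU ltl; rewrite lr.
Qed.

Lemma hits_red (S : pred lit) C :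
  (forall l, l \in C -> S l -> ~~ universal Q l.1) ->
  hits S C -> hits S (red Q C).
Proof.
move=> SE /hitsP[l lC Sl]; apply/hitsP; exists l => //.
by apply: mem_red_nonuniversal (SE l lC Sl).
Qed.

End Reduction.

Section Restriction.

Implicit Types (C D g : clause) (sigma : seq lit) (l : lit) (p : option lit).

Lemma restrictP C sigma D : restrict C sigma = Some D <->
  (forall l, l \in C -> l \notin sigma) /\
  D = [fset l in C | neg l \notin sigma].
Proof.
rewrite /restrict; case: ifPn => [/hasP[l lC ls] | /hasPn Cs]; split=> //.
- by case=> /(_ l lC); rewrite ls.
- by case=> <-; split.
- by case=> _ ->.
Qed.

Lemma restrict_fresh C sigma :
  (forall l, l \in C -> l.1 \notin vars sigma) -> restrict C sigma = Some C.
Proof.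
move=> fresh; apply/restrictP; split=> [l /fresh/notin_vars[] //|].
apply/fsetP => l; rewrite !inE; case lC: (l \in C) => //.
by have /notin_vars[_ ->] := fresh l lC.
Qed.

Lemma restrict_fsetU_fresh C D g sigma :
  (forall l, l \in g -> l.1 \notin vars sigma) ->
  restrict C sigma = Some D -> restrict (C `|` g) sigma = Some (D `|` g).
Proof.
move=> /restrict_fresh/restrictP[gs eg] /restrictP[Cs ->].
apply/restrictP; split=> [l|]; first by rewrite inE => /orP[/Cs|/gs].
by rewrite {1}eg; apply/fsetP => l; rewrite !inE andb_orl.
Qed.

Lemma restrict_unit C sigma p : uniq (vars sigma) ->
  (forall l, l \in C -> neg l \in sigma \/ p = Some l) ->
  (forall l, p = Some l -> l \in C /\ l.1 \notin vars sigma) ->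
  restrict C sigma = Some (clause_of_element p).
Proof.
move=> us falC unitC.
have fresh l : p = Some l -> l \notin sigma /\ neg l \notin sigma.
  by case/unitC=> _ /notin_vars.
apply/restrictP; split=> [l lC|].
  by case: (falC l lC) => [/(neg_notin us)|/fresh[]]; rewrite ?negK.
apply/fsetP => l; rewrite !inE; apply/idP/andP => [|[lC ls]].
  case: p {falC} unitC fresh => [q|] unitC fresh; rewrite /= inE // => /eqP ->.
  by split; [have [] := unitC q erefl | have [] := fresh q erefl].
by case: (falC l lC) ls => [-> //| -> _]; rewrite /= inE.
Qed.

End Restriction.

Section UnitClauses.

Variables (Q : prefix_of_blocks) (R : reduction_policy).
Variables (C : clause) (sigma : seq lit).

Lemma unit_under_fresh p : (forall l : lit, l \in C -> l.1 \notin vars sigma) ->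
  unit_under Q R C sigma p -> unit_clause Q R C p.
Proof. by move=> /restrict_fresh eC [D]; rewrite eC => -[<-]. Qed.

Lemma unit_under_sub p : unit_under Q R C sigma p ->
  {subset red Q [fset l in C | neg l \notin sigma] <= clause_of_element p} /\
  {subset clause_of_element p <= [fset l in C | neg l \notin sigma]}.
Proof.
by case=> _ /restrictP[_ ->] [<- _]; case: (R); split=> // l; apply: red_sub.
Qed.

Lemma unit_under_literal q : unit_under Q R C sigma (Some q) ->
  [/\ q \in C, existential Q q.1 & q.1 \notin vars sigma].
Proof.
move=> UC; have [_ /(_ q)] := unit_under_sub UC.
rewrite !inE eqxx => /(_ isT)/andP[qC nqs]; case: UC => D /restrictP[Cs _].
case=> _ /(_ _ erefl) qE; split=> //; apply/mapP => -[l ls ql].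
have [lq|lq] := eq_var (esym ql); last by rewrite -lq ls in nqs.
by have := Cs q qC; rewrite -lq ls.
Qed.

Lemma unit_under_nonuniversal p (l : lit) : unit_under Q R C sigma p ->
  l \in C -> ~~ universal Q l.1 -> neg l \in sigma \/ p = Some l.
Proof.
move=> /unit_under_sub[red_p _] lC lU.
have [ls|ls] := boolP (neg l \in sigma); [by left | right].
have : l \in clause_of_element p.
  by apply/red_p/mem_red_nonuniversal; rewrite ?inE ?lC.
by case: p {red_p} => [q|]; rewrite inE // => /eqP ->.
Qed.

Lemma unit_under_blocked q (l : lit) : unit_under Q R C sigma (Some q) ->
  l \in C -> lv Q l.1 <= lv Q q.1 -> neg l \in sigma \/ l = q.
Proof.
move=> UC lC le_lq; have [qC qE /notin_vars[_ qs]] := unit_under_literal UC.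
have [ls|ls] := boolP (neg l \in sigma); [by left | right].
have : l \in clause_of_element (Some q).
  apply: (unit_under_sub UC).1.
  by apply: mem_red_blocked qE le_lq; rewrite !inE ?lC ?qC.
by rewrite inE => /eqP.
Qed.

End UnitClauses.

Lemma unit_under_NO_RED Q (C : clause) (sigma : seq lit) p (l : lit) :
  unit_under Q NO_RED C sigma p -> l \in C -> ~~ existential Q l.1 ->
  neg l \in sigma.
Proof.
case=> D /restrictP[_ ->] [/= eq_p pE] lC lE; apply: contraNT lE => ls.
have : l \in clause_of_element p by rewrite -eq_p !inE lC.
by case: p {eq_p} pE => [q|] pE; rewrite inE // => /eqP ->; apply: pE.
Qed.

Section Falsified.

Variables (Q : prefix_of_blocks) (R : reduction_policy).
Implicit Types (C A : clause) (sigma : seq lit) (p : lit).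

(* Universal literals are exempt: when a clause propagates or conflicts under
   reduction they may still be unassigned. *)
Definition ex_falsified sigma C : Prop :=
  forall l : lit, l \in C -> ~~ universal Q l.1 -> neg l \in sigma.

Lemma ex_falsified_conflict sigma C :
  unit_under Q R C sigma None -> ex_falsified sigma C.
Proof. by move=> UC l lC lU; case: (unit_under_nonuniversal UC lC lU). Qed.

Lemma ex_falsified_red sigma C :
  ex_falsified sigma C -> ex_falsified sigma (red Q C).
Proof. by move=> falC l /red_sub; apply: falC. Qed.

Lemma ex_falsified_rcons sigma C p : (neg p \in C -> universal Q p.1) ->
  ex_falsified (rcons sigma p) C -> ex_falsified sigma C.
Proof.
move=> pU falC l lC lU; have := falC l lC lU.
rewrite mem_rcons inE => /predU1P[lp|//].
by move: lU; rewrite -[l.1]/(neg l).1 lp pU // -lp negK.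
Qed.

Lemma ex_falsified_resolve sigma C A p : unit_under Q R A sigma (Some p) ->
  ex_falsified (rcons sigma p) C -> ex_falsified sigma (resolve p C (red Q A)).
Proof.
move=> UA falC l; rewrite in_resolve => /orP[] /andP[lp] => [lC|/red_sub lA] lU.
  have := falC l lC lU; rewrite mem_rcons inE => /predU1P[nl|//].
  by rewrite -nl negK eqxx in lp.
by case: (unit_under_nonuniversal UA lA lU) => // -[pl]; rewrite pl eqxx in lp.
Qed.

End Falsified.

(** * Trails *)

Lemma assignment_cat T T' :
  assignment (T ++ T') = assignment T ++ assignment T'.
Proof. exact: pmap_cat. Qed.

Lemma assignment_rcons T e :
  assignment (rcons T e) = assignment T ++ seq_of_opt (step_element e).2.
Proof.
by rewrite -cats1 assignment_cat /assignment /=; case: (step_element e).2.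
Qed.

Lemma assignment_rcons_literal T e l : (step_element e).2 = Some l ->
  assignment (rcons T e) = rcons (assignment T) l.
Proof. by move=> el; rewrite assignment_rcons el cats1. Qed.

Lemma conflict_in_rcons T e :
  conflict_in (rcons T e) = (step_element e == (false, None)) || conflict_in T.
Proof. by rewrite /conflict_in /elements map_rcons mem_rcons inE eq_sym. Qed.

Lemma assigned_rcons T e :
  assigned (rcons T e) = assigned T ++ vars (seq_of_opt (step_element e).2).
Proof. by rewrite /assigned assignment_rcons map_cat. Qed.

Lemma assigned_cat T T' : assigned (T ++ T') = assigned T ++ assigned T'.
Proof. by rewrite /assigned assignment_cat map_cat. Qed.

Lemma assignment_elements T : assignment T = pmap snd (elements T).
Proof. by elim: T => //= e T <-. Qed.

Lemma assigned_ind (S : nat -> Prop) T :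
  (forall T1 e T2 l, T = T1 ++ e :: T2 -> (step_element e).2 = Some l ->
     (forall x, x \in assigned T1 -> S x) -> S l.1) ->
  forall x, x \in assigned T -> S x.
Proof.
elim/last_ind: T => [|T e IH] step x //; rewrite assigned_rcons mem_cat.
have ST : forall x, x \in assigned T -> S x.
  apply: IH => T1 e' T2 l eT; apply: (step T1 e' (rcons T2 e)).
  by rewrite eT rcons_cat rcons_cons.
case/orP=> [/ST //|]; case el: (step_element e).2 => [l|] //=.
by rewrite inE => /eqP ->; apply: (step T e [::]); rewrite ?cats1.
Qed.

Section Trail.

Variables (Q : prefix_of_blocks) (R : reduction_policy) (phi : cnf) (T : trail).
Hypothesis T_trail : is_trail Q R phi T.

Lemma uniq_prefix T1 T2 : T = T1 ++ T2 -> uniq (assigned T1).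
Proof.
case: T_trail => uT _ _ _ eT; move: uT.
by rewrite eT assigned_cat cat_uniq => /andP[].
Qed.

Lemma element_fresh T1 e T2 l :
  T = T1 ++ e :: T2 -> (step_element e).2 = Some l -> l.1 \notin assigned T1.
Proof.
move=> eT el.
have := @uniq_prefix (rcons T1 e) T2; rewrite cat_rcons => /(_ eT).
by rewrite assigned_rcons el cat_uniq => /and3P[_ /hasPn -> //]; rewrite inE.
Qed.

Lemma trail_propagate T1 p A T2 : T = T1 ++ Propagate p A :: T2 ->
  A \in phi /\ unit_under Q R A (assignment T1) p.
Proof.
case: T_trail => _ _ prop _ eT; have := prop (size T1) p A.
by rewrite eT onth_cat_cons take_size_cat //; apply.
Qed.

Lemma assigned_before_decision T1 d T2 (C : clause) (l : lit) :
  T = T1 ++ Decide d :: T2 -> C \in phi -> l \in C -> lv Q l.1 < lv Q d.1 ->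
  l.1 \in assigned T1.
Proof.
case: T_trail => _ dec _ _ eT Cphi lC lt_ld.
have [] := dec (size T1) d; first by rewrite eT onth_cat_cons.
rewrite eT take_size_cat // => _ /(_ C l Cphi lC) le_dl.
by apply: contraTT lt_ld => /le_dl; rewrite -leqNgt.
Qed.

Lemma conflict_free_prefix T1 e T2 : T = T1 ++ e :: T2 -> ~~ conflict_in T1.
Proof.
case: T_trail => _ _ _ last eT; apply/negP => /onthP[k].
rewrite /elements onth_map; case ek: (onth T1 k) => [[|[//|] A]|] //= _.
have kT1 : k < size T1 by rewrite -onthTE ek.
by have := last k A; rewrite eT onth_cat kT1 ek size_cat /= => /(_ erefl); lia.
Qed.

Lemma decision_not_unit k T1 d T2 (C : clause) p : natural_from Q R phi T k ->
  k <= size T1 -> T = T1 ++ Decide d :: T2 -> C \in phi ->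
  ~ unit_under Q R C (assignment T1) p.
Proof.
move=> nat kT1 eT Cphi UC.
have := nat (size T1); rewrite /natural_at eT take_size_cat //.
rewrite size_cat kT1 leq_addr.
case/(_ isT (conflict_free_prefix eT)); first by exists C, p.
by move=> q [A []]; rewrite onth_cat_cons.
Qed.

End Trail.

Section Rounds.

Variables (R : reduction_policy) (Phi : qcnf) (D : clause) (P : seq round).
Hypothesis P_proof : qcdcl_proof R Phi D P.

Lemma round_conflicting i r : onth P i = Some r -> conflicting (round_trail r).
Proof. by case/P_proof.1. Qed.

Lemma proof_size_ge_rounds : size P <= proof_size P.
Proof.
rewrite /proof_size big_tnth -[size P in leqLHS]card_ord -sum1_card.
apply: leq_sum => i _.
have ir : onth P i = Some (tnth (in_tuple P) i).
  exact: (tnth_onth _ (in_tuple P) i).1.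
by have [T1 [A ->]] := round_conflicting ir; rewrite size_rcons.
Qed.

(* A clause of the matrix that is unit before a decision kept from the previous
   trail was already unit there, so the natural condition excludes it as well. *)
Lemma round_decision_not_unit i r T1 d T2 (C : clause) p :
  onth P i = Some r -> round_trail r = T1 ++ Decide d :: T2 ->
  C \in qmatrix Phi -> ~ unit_under (qprefix Phi) R C (assignment T1) p.
Proof.
elim: i r T1 d T2 => [|i IH] r T1 d T2 ir eT CM.
  case: (P_proof.1 _ _ ir) => trT _ _ nat.
  by apply: (decision_not_unit trT nat _ eT); rewrite // inE CM.
case: (P_proof.1 _ _ ir) => trT _ _.
case ei: (onth P i) => [r'|]; last first.
  have : i.+1 < size P by rewrite -onthTE ir.
  by move/ltnW; rewrite -onthTE ei.
case=> k [kT kT' eqk nat]; have [kT1|kT1] := leqP k (size T1).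
  by apply: (decision_not_unit trT nat _ eT); rewrite // inE CM.
have eT1 : elements (take (size T1) (round_trail r')) = elements T1.
  have := congr1 (take (size T1)) eqk.
  rewrite /elements -!map_take !take_takel; try lia.
  by rewrite eT take_size_cat.
have : onth (elements (take k (round_trail r'))) (size T1) =
    Some (true, Some d).
  by rewrite -eqk /elements onth_map onth_take // eT onth_cat_cons.
rewrite /elements onth_map onth_take //.
case ee: (onth (round_trail r') (size T1)) => [[d'|]|] //= [dd]; subst d'.
rewrite assignment_elements -eT1 -assignment_elements.
exact: (IH r' _ d _ ei (cat_take_onth ee)).
Qed.

End Rounds.

Section NaturalTrails.

Variables (Q : prefix_of_blocks) (R : reduction_policy) (phi : cnf).

Definition natural_step (T : trail) (e : step) : Prop :=
  match e with
  | Decide d => [/\ d.1 \notin assigned T, bound Q d.1, lev_ord Q phi T d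
      & forall (C : clause) p, C \in phi -> ~ unit_under Q R C (assignment T) p]
  | Propagate p A => [/\ A \in phi, unit_under Q R A (assignment T) p
      & (exists2 C, C \in phi & unit_under Q R C (assignment T) None) ->
        p = None]
  end.

Definition natural_prefix (T : trail) : Prop :=
  is_trail Q R phi T /\ forall k, k < size T -> natural_at Q R phi T k.

Lemma natural_prefix_nil : natural_prefix [::].
Proof. by split=> //; split=> // k ?; rewrite onth0n. Qed.

Lemma conflict_free_onth T k A : ~~ conflict_in T ->
  onth T k <> Some (Propagate None A).
Proof.
move=> /negP cT ek; apply: cT; apply/onthP; exists k.
by rewrite /elements onth_map ek.
Qed.

Lemma natural_step_fresh T e l :
  natural_step T e -> (step_element e).2 = Some l -> l.1 \notin assigned T.
Proof.
case: e => [d [fresh _ _ _] [<-] // | p A [_ UA _] /= pl].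
by rewrite pl in UA; have [] := unit_under_literal UA.
Qed.

Lemma is_trail_rcons T e : is_trail Q R phi T -> ~~ conflict_in T ->
  natural_step T e -> is_trail Q R phi (rcons T e).
Proof.
move=> [uT decT propT _] cT stepT; have takeT k x : onth T k = Some x ->
    take k (rcons T e) = take k T.
  by move=> ek; rewrite -cats1 takel_cat // ltnW // -onthTE ek.
have take_size : take (size T) (rcons T e) = T by rewrite -cats1 take_size_cat.
split.
- rewrite assigned_rcons cat_uniq uT /=.
  case el: (step_element e).2 => [l|] //=.
  by rewrite orbF andbT; apply: natural_step_fresh el.
- move=> k d; rewrite onth_rcons; case: eqP => [-> [ed]|_ ek].
    by rewrite take_size; rewrite ed in stepT; case: stepT.
  by rewrite (takeT _ _ ek); apply: decT.
- move=> k p A; rewrite onth_rcons; case: eqP => [-> [ep]|_ ek].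
    by rewrite take_size; rewrite ep in stepT; case: stepT.
  by rewrite (takeT _ _ ek); apply: propT.
- move=> k A; rewrite onth_rcons size_rcons; case: eqP => [-> //|_ ek].
  by case: (conflict_free_onth cT ek).
Qed.

Lemma natural_prefix_rcons T e : natural_prefix T -> ~~ conflict_in T ->
  natural_step T e -> natural_prefix (rcons T e).
Proof.
move=> [trT natT] cT stepT; split; first exact: is_trail_rcons.
move=> k; rewrite size_rcons ltnS leq_eqVlt => /predU1P[->|kT].
  rewrite /natural_at -cats1 take_size_cat // onth_cat_cons.
  move=> _ [C [p [Cphi UC]]].
  case: e stepT => [d [_ _ _ /(_ C p Cphi)] // | q A [Aphi UA botA]].
  by exists q, A.
move: (natT k kT); rewrite /natural_at -cats1 takel_cat ?(ltnW kT) //.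
by rewrite onth_cat kT.
Qed.

Lemma natural_from_conflict T A : natural_prefix (rcons T (Propagate None A)) ->
  natural_from Q R phi (rcons T (Propagate None A)) 0.
Proof.
move=> [_ natT] k; rewrite /= leq_eqVlt => /predU1P[->|]; last exact: natT.
by rewrite /natural_at take_size conflict_in_rcons eqxx.
Qed.

End NaturalTrails.

Lemma refutation_of_natural_conflict R (Phi : qcnf) T A :
  natural_prefix (qprefix Phi) R (qmatrix Phi) T -> ~~ conflict_in T ->
  A \in qmatrix Phi -> unit_under (qprefix Phi) R A (assignment T) None ->
  fset0 \in learnable (qprefix Phi) (rcons T (Propagate None A)) ->
  exists2 P, qcdcl_refutation R Phi P & proof_size P = (size T).+1.
Proof.
set T' := rcons _ _ => natT cT AM UA /splitPr; case eL: _ / => [L1 L2].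
have natT' : natural_prefix (qprefix Phi) R (qmatrix Phi) T'.
  by apply: natural_prefix_rcons => //; split.
pose r := Round T' fset0 (rcons L1 fset0).
exists [:: r]; last by rewrite /proof_size big_seq1 size_rcons.
split; last by exists [::], r.
move=> i r' /onth1P[-> <-].
have -> : qmatrix Phi `|` learned (take 0 [:: r]) = qmatrix Phi.
  by apply/fsetP => C; rewrite take0 !inE orbF.
split; [exact: natT'.1 | by exists T, A | | exact: natural_from_conflict].
by split; [rewrite /= eL -cat_rcons prefix_prefix | exists L1].
Qed.

(** * Polynomial and exponential growth *)

Lemma horner_nat_leq (p : {poly nat}) x y : x <= y -> horner p x <= horner p y.
Proof.
move=> xy; elim/poly_ind: p => [|p c IH]; first by rewrite !horner0.
by rewrite !hornerE; apply: leq_add => //; apply: leq_mul.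
Qed.

Lemma horner_nat_monomial_bound (p : {poly nat}) :
  exists c d, forall x, horner p x <= c * x.+1 ^ d.
Proof.
elim/poly_ind: p => [|p c [c' [d IH]]].
  by exists 0, 0 => x; rewrite horner0.
exists (c' + c), d.+1 => x; rewrite !hornerE mulnDl; apply: leq_add.
  by rewrite expnSr mulnA; apply: leq_mul.
by rewrite leq_pmulr // expn_gt0.
Qed.

Lemma exp2_dominates_monomial c d :
  exists N, forall n, N <= n -> c * n ^ d < 2 ^ n.
Proof.
elim: d c => [|d IH] c.
  by exists c => n cn; rewrite muln1; apply: leq_ltn_trans cn (ltn_expl _ _).
have [N domN] := IH (c * 2 ^ d.+1); exists N.*2 => n nN; pose h := n - n./2.
have nd : n ^ d <= 2 ^ d * h ^ d.
  by rewrite -expnMn; case: (d) => // e; rewrite leq_exp2r // /h; lia.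
have nh : n <= 2 * 2 ^ n./2 by have := ltn_expl n./2 (isT : 1 < 2); lia.
have -> : 2 ^ n = 2 ^ h * 2 ^ n./2.
  by rewrite -expnD; congr (2 ^ _); rewrite /h; lia.
have le_hd : c * n ^ d.+1 <= c * 2 ^ d.+1 * h ^ d * 2 ^ n./2.
  have := leq_mul (leqnn c) (leq_mul nd nh).
  by rewrite -expnSr [2 ^ d.+1]expnSr; lia.
apply: leq_ltn_trans le_hd _; rewrite ltn_pmul2r ?expn_gt0 //.
by apply: domN; rewrite /h; lia.
Qed.

Lemma exp2_dominates (p : {poly nat}) :
  exists N, forall n, N <= n -> horner p n < 2 ^ n.
Proof.
have [c [d p_le]] := horner_nat_monomial_bound p.
have [N domN] := exp2_dominates_monomial (c * 2) d; exists N => n nN.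
apply: leq_ltn_trans (p_le n) _.
by have := domN n.+1 (leqW nN); rewrite expnS; lia.
Qed.

Lemma superpoly_of_exp2 R (Phi : nat -> qcnf) :
  (exists p : {poly nat}, forall n, qcnf_size (Phi n) <= horner p n) ->
  (forall n P, qcdcl_refutation R (Phi n) P -> 2 ^ n <= proof_size P) ->
  superpoly_size_refutations R Phi.
Proof.
move=> [p size_p] hard q; have [N domN] := exp2_dominates (q \Po p)%R.
exists N => n nN P /hard; apply: leq_trans; apply: leq_ltn_trans (domN n nN).
by rewrite horner_comp; apply: horner_nat_leq.
Qed.

Lemma not_simulates_of_separation R R' (Phi : nat -> qcnf) :
  poly_size_refutations R Phi -> superpoly_size_refutations R' Phi ->
  ~ simulates R' R.
Proof.
move=> [p easy] hard [q sim].
have [N /(_ N (leqnn N)) lt_size] := hard (q \Po p)%R.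
have [P PR P_le] := easy N; have [P' /lt_size] := sim _ _ PR.
rewrite horner_comp => lt_P' P'_le; move: lt_P'; rewrite ltnNge => /negP; apply.
exact: leq_trans P'_le (horner_nat_leq _ P_le).
Qed.

(** * The separating formulas *)

Definition nat_interval (lo k : nat) : {fset nat} := [fset x in iota lo k].

Lemma in_nat_interval lo k x : (x \in nat_interval lo k) = (lo <= x < lo + k).
Proof. by rewrite !inE mem_iota. Qed.

Lemma card_nat_interval lo k : #|` nat_interval lo k| = k.
Proof. by rewrite card_fseq undup_id ?iota_uniq // size_iota. Qed.

Section Formula.

Variable m : nat.

(* The variable x_i is [i] itself, for [i < m]. *)
Local Notation uvar := m (only parsing).
Local Notation avar i := (m.+1 + i).
Local Notation wvar := m.*2.+1.
Local Notation tvar := m.*2.+2.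
Local Notation is_avar x := (m < x <= m.*2).

Definition blocks : prefix_of_blocks :=
  [:: (QEx, nat_interval 0 m); (QAll, nat_interval uvar 1);
      (QEx, nat_interval (avar 0) m); (QAll, nat_interval wvar 1);
      (QEx, nat_interval tvar 1)].

Lemma lv_blocks x : lv blocks x =
  1 + (m <= x) + (m < x) + (m.*2 < x) + (wvar < x) + (tvar < x).
Proof. by rewrite /lv /= !in_nat_interval; do !case: ifP => /=; lia. Qed.

Lemma existential_blocks x :
  existential blocks x = [|| x < m, is_avar x | x == tvar].
Proof. by rewrite /existential /= !in_nat_interval; lia. Qed.

Lemma universal_blocks x : universal blocks x = (x == uvar) || (x == wvar).
Proof. by rewrite /universal /= !in_nat_interval; lia. Qed.

Lemma bound_blocks x : bound blocks x = (x <= tvar).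
Proof. by rewrite /bound /= !in_nat_interval; lia. Qed.

Lemma existential_not_universal x :
  existential blocks x -> ~~ universal blocks x.
Proof. by rewrite existential_blocks universal_blocks; lia. Qed.

Lemma w_universal : universal blocks wvar.
Proof. by rewrite universal_blocks eqxx orbT. Qed.

Lemma lv_leq x y : x <= y -> lv blocks x <= lv blocks y.
Proof. by rewrite !lv_blocks; lia. Qed.

Lemma lv_ltn_universal x y :
  universal blocks y -> (lv blocks x < lv blocks y) = (x < y).
Proof. by rewrite universal_blocks !lv_blocks; lia. Qed.

Definition x_core (i : nat) (b c : bool) : clause :=
  [fset (i, b); (uvar, c); (avar i, true)].

Definition a_core (c : bool) : clause :=
  (uvar, c) |` [fset l in [seq (avar i, false) | i <- iota 0 m]].

Definition core : seq clause :=
  [seq x_core i bc.1 bc.2 | i <- iota 0 m, bc <- enum {: bool * bool}]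
    ++ [seq a_core c | c <- enum {: bool}].

Definition wt_clause (b : bool) : clause := (tvar, b) |` [fset (wvar, true)].

(* [R] is the policy under which the formula is hard. *)
Definition guard (R : reduction_policy) : clause :=
  if R is RED then [fset (wvar, false)] else fset0.

Definition gadget (R : reduction_policy) : seq clause :=
  if R is RED then [:: wt_clause true; wt_clause false]
  else [:: [fset (wvar, true)]].

Definition sep_matrix (R : reduction_policy) : cnf :=
  [fset C in [seq h `|` guard R | h <- core] ++ gadget R].

Lemma in_x_core i b c (l : lit) : (l \in x_core i b c) =
  [|| l == (i, b), l == (uvar, c) | l == (avar i, true)].
Proof. by rewrite !inE -orbA. Qed.

Lemma in_a_core c (l : lit) :
  (l \in a_core c) = (l == (uvar, c)) || is_avar l.1 && ~~ l.2.
Proof.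
rewrite !inE; congr orb; apply/mapP/andP => [[i + ->]|[l1 l2]].
  by rewrite mem_iota => im; split=> //=; lia.
exists (l.1 - m.+1); first by rewrite mem_iota; lia.
by rewrite subnKC; [case: l l2 {l1} => x [] | lia].
Qed.

Lemma coreP h : reflect
  ((exists i b c, i < m /\ h = x_core i b c) \/ exists c, h = a_core c)
  (h \in core).
Proof.
rewrite mem_cat; apply: (iffP orP) => -[].
- case/allpairsP=> -[i [b c]] [+ _ ->]; rewrite mem_iota => im.
  by left; exists i, b, c.
- by case/mapP=> c _ ->; right; exists c.
- case=> i [b [c [im ->]]]; left; apply/allpairsP.
  by exists (i, (b, c)); rewrite mem_iota mem_enum.
- by case=> c ->; right; apply: map_f; rewrite mem_enum.
Qed.

Lemma in_wt_clause b (l : lit) :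
  (l \in wt_clause b) = (l == (tvar, b)) || (l == (wvar, true)).
Proof. by rewrite !inE. Qed.

Lemma red_wt_clause b : red blocks (wt_clause b) = wt_clause b.
Proof.
apply: (@red_blocked_id _ _ (tvar, b)) => [||l].
- by rewrite in_wt_clause eqxx.
- by rewrite existential_blocks eqxx !orbT.
- by rewrite in_wt_clause => /orP[]/eqP ->; apply: lv_leq.
Qed.

Lemma guard_lit R (l : lit) : l \in guard R -> l = (wvar, false).
Proof. by case: R; rewrite inE // => /eqP. Qed.

Lemma gadget_vars R (C : clause) (l : lit) :
  C \in gadget R -> l \in C -> m.*2 < l.1 <= tvar.
Proof.
case: R; last by rewrite inE => /eqP ->; rewrite inE => /eqP -> /=; lia.
by rewrite !inE => /orP[]/eqP ->; rewrite in_wt_clause => /orP[]/eqP -> /=; lia.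
Qed.

Lemma in_sep_matrix R (C : clause) : reflect
  ((exists2 h, h \in core & C = h `|` guard R) \/ C \in gadget R)
  (C \in sep_matrix R).
Proof.
rewrite /sep_matrix in_fset mem_cat; apply: (iffP orP) => -[].
- by case/mapP=> h hcore ->; left; exists h.
- by right.
- by case=> h hcore ->; left; apply: map_f.
- by right.
Qed.

Lemma core_in_sep_matrix R h : h \in core -> h `|` guard R \in sep_matrix R.
Proof. by move=> hcore; apply/in_sep_matrix; left; exists h. Qed.

Lemma wt_clause_in_sep_matrix b : wt_clause b \in sep_matrix RED.
Proof. by apply/in_sep_matrix; right; case: b; rewrite !inE eqxx ?orbT. Qed.

Lemma w_clause_in_sep_matrix : [fset (wvar, true)] \in sep_matrix NO_RED.
Proof. by apply/in_sep_matrix; right; rewrite inE. Qed.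

Lemma core_vars h (l : lit) : h \in core -> l \in h -> l.1 <= m.*2.
Proof.
case/coreP=> [[i [b [c [im ->]]]]|[c ->]].
  by rewrite in_x_core => /or3P[]/eqP -> /=; lia.
by rewrite in_a_core => /predU1P[-> /=|/andP[]]; lia.
Qed.

Lemma sep_matrix_vars R (C : clause) (l : lit) :
  C \in sep_matrix R -> l \in C -> l.1 <= tvar.
Proof.
case/in_sep_matrix=> [[h hcore ->]|Cg lC]; last first.
  by have /andP[] := gadget_vars Cg lC.
by rewrite inE => /orP[/(core_vars hcore)|/guard_lit -> //]; lia.
Qed.

Lemma sep_matrix_closed R (C : clause) (l : lit) :
  C \in sep_matrix R -> l \in C -> bound blocks l.1.
Proof. by rewrite bound_blocks; apply: sep_matrix_vars. Qed.

Lemma gadget_nontaut R (C : clause) : C \in gadget R -> ~~ tautological C.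
Proof.
case: R => [|/[!inE]/eqP ->]; last first.
  by apply: (@not_tautological xpredT) => l; rewrite inE => /eqP ->.
have nontaut b : ~~ tautological (wt_clause b).
  apply: (@not_tautological (fun x => (x == wvar) || b)) => l.
  by rewrite in_wt_clause => /orP[]/eqP -> /=; lia.
by rewrite mem_seq2 => /orP[]/eqP ->.
Qed.

Lemma sep_matrix_nontaut R (C : clause) :
  C \in sep_matrix R -> ~~ tautological C.
Proof.
case/in_sep_matrix=> [[h /coreP core_h ->]|/gadget_nontaut //].
case: core_h => [[i [b [c [im ->]]]]|[c ->]].
  pose s x := if x == i then b else if x == uvar then c else is_avar x.
  apply: (@not_tautological s) => l; rewrite inE in_x_core /s.
  case/orP=> [/or3P[]/eqP ->|/guard_lit ->] /=; first by rewrite eqxx.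
  - by rewrite eqxx ifN //; lia.
  - by rewrite !ifN; lia.
  - by rewrite !ifN; lia.
apply: (@not_tautological (fun x => (x == uvar) && c)) => l.
rewrite inE in_a_core => /orP[/orP[/eqP ->|/andP[lm /negPf ->]]|/guard_lit ->] /=.
- by rewrite eqxx.
- by rewrite gtn_eqF //; lia.
- by rewrite gtn_eqF //; lia.
Qed.

Lemma blocks_disjoint :
  pairwise (fun B B' : block => [disjoint B.2 & B'.2]) blocks.
Proof.
have disj lo k lo' k' : lo + k <= lo' ->
    [disjoint nat_interval lo k & nat_interval lo' k'].
  by move=> le_lo; apply/fdisjointP => x; rewrite !in_nat_interval; lia.
by rewrite /= !disj //; lia.
Qed.

Lemma blocks_nonempty : 0 < m -> all (fun B : block => B.2 != fset0) blocks.
Proof. by move=> m_gt0; rewrite /= -!cardfs_gt0 !card_nat_interval m_gt0. Qed.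

Definition sep_formula (R : reduction_policy) (m_gt0 : 0 < m) : qcnf :=
  QCNF (blocks_nonempty m_gt0) blocks_disjoint isT (@sep_matrix_closed R)
    (@sep_matrix_nontaut R).

Lemma card_sep_clause R (C : clause) :
  C \in sep_matrix R -> #|` C| <= m * 4 + 6.
Proof.
move=> CM; pose lits : seq lit :=
  [seq (x, b) | x <- iota 0 tvar.+1, b <- [:: true; false]].
have : C `<=` [fset l in lits].
  apply/fsubsetP => -[x b] lC; rewrite in_fset; apply/allpairsP; exists (x, b).
  by rewrite mem_iota ltnS (sep_matrix_vars CM lC) /= !inE; case: b {lC}.
move=> /fsubset_leq_card/leq_trans; apply; rewrite card_fseq.
by apply: leq_trans (size_undup _) _; rewrite size_allpairs size_iota /=; lia.
Qed.

Lemma card_sep_matrix R : #|` sep_matrix R| <= m * 4 + 4.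
Proof.
rewrite card_fseq; apply: leq_trans (size_undup _) _.
rewrite size_cat size_map size_cat size_allpairs size_iota -cardT card_prod.
rewrite (size_map a_core) -cardT card_bool.
by case: R => /=; lia.
Qed.

Lemma sep_formula_size_ge R (m_gt0 : 0 < m) :
  m.*2 + 3 <= qcnf_size (sep_formula R m_gt0).
Proof. by rewrite /qcnf_size /= !big_cons big_nil /= !card_nat_interval; lia. Qed.

Lemma sep_formula_size_le R (m_gt0 : 0 < m) :
  qcnf_size (sep_formula R m_gt0) <= 16 * m.+2 ^ 2.
Proof.
have sum_le : \sum_(C <- sep_matrix R) (#|` C|).+1 <= (m * 4 + 7) * (m * 4 + 4).
  apply: (@leq_trans (\sum_(C <- sep_matrix R) (m * 4 + 7))).
    rewrite big_seq [leqRHS]big_seq; apply: leq_sum => C /card_sep_clause; lia.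
  rewrite big_const_seq count_predT iter_addn_0 leq_mul2l; apply/orP; right.
  exact: card_sep_matrix.
rewrite /qcnf_size /= !big_cons big_nil /= !card_nat_interval.
by apply: leq_trans (leq_add (leqnn _) sum_le) _; rewrite expnS expn1; lia.
Qed.

Lemma qtrue_under_blocks phi s : qtrue_under blocks phi s ->
  exists2 s' : nat -> bool, s' wvar = false &
    forall C : clause, C \in phi -> exists2 l : lit, l \in C & s' l.1 = l.2.
Proof.
case=> sx [_ /(_ sx (fun _ _ => erefl))[sa [_ all_w]]].
have [x xw|st [stw sat]] := all_w (fun x => (x != wvar) && sa x).
  by rewrite (_ : x != _) //; move: xw; rewrite in_nat_interval; lia.
by exists st => //; rewrite stw ?eqxx // in_nat_interval; lia.
Qed.

Lemma sep_formula_false R (m_gt0 : 0 < m) : qfalse (sep_formula R m_gt0).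
Proof.
move=> /qtrue_under_blocks[s sw sat]; case: R sat => sat.
  have st b : s tvar = b.
    have [l] := sat _ (wt_clause_in_sep_matrix b).
    by rewrite in_wt_clause => /orP[]/eqP -> //=; rewrite sw.
  by have := st true; rewrite (st false).
have [l] := sat _ w_clause_in_sep_matrix.
by rewrite inE => /eqP -> /=; rewrite sw.
Qed.

(** * The lower bound *)

Section CoreClauses.

Variable R : reduction_policy.

Lemma core_unit_under h (sigma : seq lit) p : h \in core -> uniq (vars sigma) ->
  (forall x, x \in vars sigma -> x <= m.*2) ->
  (forall l : lit, l \in h -> neg l \in sigma \/ p = Some l) ->
  (forall l : lit, p = Some l ->
     [/\ l \in h, l.1 \notin vars sigma & is_avar l.1]) ->
  exists2 C, C \in sep_matrix R & unit_under blocks R C sigma p.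
Proof.
move=> hcore us small fal_h unit_h.
exists (h `|` guard R); first exact: core_in_sep_matrix.
exists (clause_of_element p `|` guard R).
  apply: restrict_fsetU_fresh => [l /guard_lit ->|].
    by apply/negP => /small /=; lia.
  by apply: restrict_unit us fal_h _ => l /unit_h[].
split; last by move=> l /unit_h[_ _ lm]; rewrite existential_blocks lm orbT.
have p_avar (l : lit) : l \in clause_of_element p -> is_avar l.1.
  case: p {fal_h} unit_h => [q|] unit_h; rewrite inE // => /eqP ->.
  by have [] := unit_h q.
case: R; last exact: fsetU0.
apply: red_fsetU_trailing => [l /p_avar lm | l /guard_lit ->].
  by rewrite universal_blocks; lia.
split=> [|q]; first exact: w_universal.
rewrite inE lv_ltn_universal ?w_universal //.
case/orP=> [/p_avar qm _ | /guard_lit ->]; first by rewrite /=; lia.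
by move=> /existential_not_universal; rewrite w_universal.
Qed.

Lemma core_propagates (sigma : seq lit) i : i < m -> uniq (vars sigma) ->
  (forall x, x \in vars sigma -> x <= m.*2) ->
  i \in vars sigma -> uvar \in vars sigma -> avar i \notin vars sigma ->
  exists2 C, C \in sep_matrix R
    & unit_under blocks R C sigma (Some (avar i, true)).
Proof.
move=> im us small /assigned_falsified[b bs] /assigned_falsified[c cs] a_fresh.
apply: (@core_unit_under (x_core i b c)) => // [|l|l [<-]].
- by apply/coreP; left; exists i, b, c.
- by rewrite in_x_core => /or3P[]/eqP ->; [left | left | right].
- by rewrite in_x_core eqxx !orbT; split=> //=; lia.
Qed.

Lemma core_conflict (sigma : seq lit) : uniq (vars sigma) ->
  (forall x, x \in vars sigma -> x <= m.*2) ->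
  (forall x, x <= m.*2 -> x \in vars sigma) ->
  exists2 C, C \in sep_matrix R & unit_under blocks R C sigma None.
Proof.
move=> us small total.
have falsified x : x <= m.*2 -> exists b, neg (x, b) \in sigma.
  by move=> /total/assigned_falsified.
have [|c cs] := falsified uvar; first by lia.
have [/allP all_a|] :=
    boolP (all (fun i => (avar i, true) \in sigma) (iota 0 m)).
  apply: (@core_unit_under (a_core c)) => // [|l].
    by apply/coreP; right; exists c.
  rewrite in_a_core => /predU1P[-> |/andP[lm l2]]; left=> //.
  have -> : neg l = (avar (l.1 - m.+1), true).
    by rewrite /neg (negPf l2); congr pair; lia.
  by apply: all_a; rewrite mem_iota; lia.
case/allPn=> i; rewrite mem_iota => im aT.
have [|b bs] := falsified i; first by lia.
have [|a a_s] := falsified (avar i); first by lia.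
apply: (@core_unit_under (x_core i b c)) => // [|l].
  by apply/coreP; left; exists i, b, c.
rewrite in_x_core => /or3P[]/eqP ->; left=> //.
by case: a a_s => // a_s; rewrite a_s in aT.
Qed.

Lemma occurs_in_sep_matrix x : x <= m.*2 ->
  exists2 C : clause, C \in sep_matrix R & exists2 l : lit, l \in C & l.1 = x.
Proof.
move=> xm; have [xlt|xge] := ltnP x m.
  exists (x_core x true true `|` guard R).
    by apply/core_in_sep_matrix/coreP; left; exists x, true, true.
  by exists (x, true); rewrite // inE in_x_core eqxx.
exists (a_core false `|` guard R).
  by apply/core_in_sep_matrix/coreP; right; exists false.
exists (x, false); rewrite // inE in_a_core xpair_eqE eqxx andbT /=; lia.
Qed.

Lemma gadget_not_unit_under (C : clause) (sigma : seq lit) p : C \in gadget R ->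
  (forall x, x \in vars sigma -> x <= m.*2) -> ~ unit_under blocks R C sigma p.
Proof.
move=> Cg small /unit_under_fresh[].
  by move=> l /(gadget_vars Cg) lw; apply/negP => /small; lia.
move=> eC pE; have : (wvar, true) \in clause_of_element p.
  rewrite -eC; move: Cg; rewrite /gadget; case: (R) => /=; last first.
    by rewrite inE => /eqP ->; rewrite inE.
  have wC b : (wvar, true) \in wt_clause b by rewrite in_wt_clause eqxx orbT.
  by rewrite mem_seq2 => /orP[]/eqP ->; rewrite red_wt_clause.
case: p {eC} pE => [q|]; rewrite inE // => pE /eqP wq.
have := pE q erefl; rewrite -wq => /existential_not_universal.
by rewrite w_universal.
Qed.

End CoreClauses.

(* The literals x_i, ~x_i, ~a_i, and a_j for j <> i.  They meet every core
   clause and, being consistent on the a-variables, every resolvent over those. *)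
Definition probe (i : nat) (l : lit) : bool :=
  (l.1 == i) || is_avar l.1 && (l.2 == (l.1 != avar i)).

Definition u_lit (l : lit) : bool := l.1 == uvar.
Definition a_lit (l : lit) : bool := is_avar l.1.

Lemma a_lit_nonuniversal (l : lit) : a_lit l -> ~~ universal blocks l.1.
Proof. by rewrite /a_lit universal_blocks; lia. Qed.

Record core_like (C : clause) : Prop := CoreLike {
  core_like_vars : forall l : lit, l \in C -> l.1 <= wvar;
  core_like_u : hits u_lit C;
  core_like_probe : forall i, i < m -> hits (probe i) C
}.

Lemma core_like_core R h : h \in core -> core_like (h `|` guard R).
Proof.
move=> hcore; case/coreP: (hcore) => [[i [b [c [im eh]]]]|[c eh]]; split.
- by move=> l; rewrite inE => /orP[/(core_vars hcore)|/guard_lit -> //]; lia.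
- by apply/hitsP; exists (uvar, c); rewrite /u_lit //= eh inE in_x_core eqxx orbT.
- move=> j jm; apply/hitsP; have [->|nji] := eqVneq j i.
    by exists (i, b); rewrite ?eh ?inE ?in_x_core ?eqxx // /probe eqxx.
  exists (avar i, true); first by rewrite eh inE in_x_core eqxx !orbT.
  by rewrite /probe /=; lia.
- by move=> l; rewrite inE => /orP[/(core_vars hcore)|/guard_lit -> //]; lia.
- by apply/hitsP; exists (uvar, c); rewrite /u_lit //= eh inE in_a_core eqxx.
- move=> j jm; apply/hitsP.
  have am : is_avar (avar j, false).1 by rewrite /=; lia.
  exists (avar j, false); first by rewrite eh inE in_a_core am orbT.
  by rewrite /probe am /= eqxx orbT.
Qed.

Lemma hits_a_core R h : 0 < m -> h \in core -> hits a_lit (h `|` guard R).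
Proof.
move=> m_gt0 /coreP[[i [b [c [im ->]]]]|[c ->]]; apply/hitsP.
  exists (avar i, true); last by rewrite /a_lit /=; lia.
  by rewrite inE in_x_core eqxx !orbT.
have am : is_avar (avar 0, false).1 by rewrite /=; lia.
by exists (avar 0, false); rewrite // inE in_a_core am orbT.
Qed.

Lemma core_like_resolve p C D : a_lit p -> core_like C -> core_like D ->
  core_like (resolve p C D).
Proof.
move=> pa [varsC uC probeC] [varsD uD probeD]; split.
- move=> l; rewrite in_resolve.
  by case/orP=> /andP[_]; [apply: varsC | apply: varsD].
- by apply: hits_resolve => //; move: pa; rewrite /a_lit /u_lit /=; lia.
- move=> i im; apply: hits_resolve (probeC i im) (probeD i im).
  by move: pa; rewrite /a_lit /probe /=; case: (p.2); lia.
Qed.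

Lemma hits_a_red C : hits a_lit C -> hits a_lit (red blocks C).
Proof. by apply: hits_red => l _; apply: a_lit_nonuniversal. Qed.

Lemma core_like_red C : core_like C -> hits a_lit C -> core_like (red blocks C).
Proof.
move=> [varsC /hitsP[u uC /eqP um] probeC] /hitsP[a aC am]; split.
- by move=> l /red_sub; apply: varsC.
- apply/hitsP; exists u; last exact/eqP; move: am; rewrite /a_lit => am.
  apply: (mem_red_blocked uC aC); first by rewrite existential_blocks am orbT.
  by apply: lv_leq; lia.
- move=> i im; apply: hits_red (probeC i im) => l _.
  by rewrite /probe universal_blocks; lia.
Qed.

Lemma red_core_like_x_vars C (l : lit) : core_like C -> ~~ hits a_lit C ->
  l \in red blocks C -> l.1 < m.
Proof.
move=> [varsC _ _] /hasPn no_a lr; have lC := red_sub lr.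
have := no_a _ lC; have := varsC _ lC; rewrite /a_lit => lw la.
apply: contraTT lr => lm; apply: notin_red_trailing.
  by rewrite universal_blocks; lia.
move=> q qC; rewrite existential_blocks.
rewrite lv_ltn_universal ?universal_blocks; last by lia.
by have := no_a _ qC; have := varsC _ qC; rewrite /a_lit; lia.
Qed.

Definition agrees (s : {ffun 'I_m -> bool}) (l : lit) : bool :=
  [exists i : 'I_m, l == (i : nat, s i)].

Implicit Types W : {set {ffun 'I_m -> bool}}.

Definition falsified_within W (C : clause) : Prop :=
  (forall l : lit, l \in C -> l.1 < m) /\
  (forall s, s \notin W -> hits (agrees s) C).

Lemma falsified_withinS W W' C :
  W \subset W' -> falsified_within W C -> falsified_within W' C.
Proof.
move=> /subsetP sW [varsC hitsC]; split=> // s sW'; apply: hitsC.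
by apply: contra sW'; apply: sW.
Qed.

Lemma falsified_within_red W C : falsified_within W C -> red blocks C = C.
Proof.
move=> [varsC _]; apply: red_nonuniversal_id => l /varsC.
by rewrite universal_blocks; lia.
Qed.

Lemma falsified_within_resolve W p C D : falsified_within W C ->
  falsified_within W D -> falsified_within W (resolve p C D).
Proof.
move=> [varsC hitsC] [varsD hitsD]; split.
  move=> l; rewrite in_resolve.
  by case/orP=> /andP[_]; [apply: varsC | apply: varsD].
move=> s sW; apply: hits_resolve (hitsC s sW) (hitsD s sW).
apply/negP => /andP[/existsP[i /eqP ->] /existsP[j /eqP[/val_inj ->]]].
by case: (s j).
Qed.

Definition weak_clause W (C : clause) : Prop :=
  falsified_within W C \/ core_like C /\ hits a_lit C.

Lemma weak_clauseS W W' C : W \subset W' -> weak_clause W C -> weak_clause W' C.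
Proof. by move=> sW [/(falsified_withinS sW)|]; [left | right]. Qed.

Section ConflictAnalysis.

Variables (R : reduction_policy) (phi : cnf) (T : trail).
Variable W : {set {ffun 'I_m -> bool}}.
Hypothesis sep_matrix_phi : {subset sep_matrix R <= phi}.
Hypothesis phi_weak : forall C : clause,
  C \in phi -> weak_clause W C \/ C \in gadget R.
Hypothesis T_trail : is_trail blocks R phi T.
Hypothesis T_natural : forall T1 d T2, T = T1 ++ Decide d :: T2 ->
  forall (C : clause) p, C \in sep_matrix R ->
  ~ unit_under blocks R C (assignment T1) p.

Lemma lower_level_assigned T1 d T2 x : T = T1 ++ Decide d :: T2 ->
  x <= m.*2 -> lv blocks x < lv blocks d.1 -> x \in assigned T1.
Proof.
move=> eT /(occurs_in_sep_matrix R)[C /sep_matrix_phi Cphi [l lC <-]].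
exact: assigned_before_decision T_trail _ _ _ _ _ eT Cphi lC.
Qed.

(* When w is about to be decided all lower variables are assigned, and some core
   clause is falsified. *)
Lemma assigned_le x : x \in assigned T -> x <= m.*2.
Proof.
move: x; apply: assigned_ind => T1 [d|p A] T2 l eT /= => [[<-]|pl] small.
  rewrite leqNgt; apply/negP => dm.
  have uT1 := uniq_prefix T_trail eT.
  have [y ym|C CM] := core_conflict R uT1 small; last exact: (T_natural eT CM).
  by apply: (lower_level_assigned eT ym); rewrite !lv_blocks; lia.
have [/phi_weak Aweak UA] := trail_propagate T_trail eT.
rewrite pl in UA; have [lA lE _] := unit_under_literal UA.
case: Aweak => [[[varsA _]|[[varsA _ _] _]]|Ag].
- by have := varsA _ lA; lia.
- by have := varsA _ lA; move: lE; rewrite existential_blocks; lia.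
- by case: (gadget_not_unit_under Ag small UA).
Qed.

Lemma assigned_prefix_le T1 T2 : T = T1 ++ T2 ->
  forall x, x \in assigned T1 -> x <= m.*2.
Proof.
by move=> eT x xT1; apply: assigned_le; rewrite eT assigned_cat mem_cat xT1.
Qed.

Lemma antecedent_weak T1 p A T2 :
  T = T1 ++ Propagate p A :: T2 -> weak_clause W A.
Proof.
move=> eT; have [/phi_weak[//|Ag] UA] := trail_propagate T_trail eT.
by case: (gadget_not_unit_under Ag (assigned_prefix_le eT) UA).
Qed.

Lemma x_assigned_first T1 e T2 l y : T = T1 ++ e :: T2 ->
  (step_element e).2 = Some l -> l.1 < m -> y \in assigned T1 -> y < m.
Proof.
move=> eT el lm; have fresh := element_fresh T_trail eT el.
move: y; apply: assigned_ind => T1' e' T2' k eT1 ek xs.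
have {}eT : T = T1' ++ e' :: (T2' ++ e :: T2) by rewrite eT eT1 -catA.
rewrite ltnNge; apply/negP => km.
case: e' ek eT1 eT => [d [dk]|p A /= pk] eT1 eT.
  case/negP: fresh; rewrite eT1 assigned_cat mem_cat.
  by rewrite (lower_level_assigned eT) ?dk // ?lv_blocks; lia.
have [_ UA] := trail_propagate T_trail eT; rewrite pk in UA.
have [kA kE _] := unit_under_literal UA.
case: (antecedent_weak eT) => [[varsA _]|[[_ /hitsP[u uA /eqP um] _] _]].
  by have := varsA _ kA; lia.
case: (unit_under_blocked UA uA) => [|/mem_var/xs|uk].
- by apply: lv_leq; rewrite um.
- by rewrite /= um ltnn.
- by move: kE; rewrite -uk um existential_blocks; lia.
Qed.

Lemma decision_not_a T1 d T2 : T = T1 ++ Decide d :: T2 -> ~~ a_lit d.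
Proof.
move=> eT; apply/negP; rewrite /a_lit => dm; pose i := d.1 - m.+1.
have di : avar i = d.1 by rewrite /i; lia.
have below x : x <= m -> x \in assigned T1.
  by move=> xm; apply: (lower_level_assigned eT); rewrite ?lv_blocks; lia.
have [||||||C CM] := @core_propagates R (assignment T1) i; rewrite ?di.
- by rewrite /i; lia.
- exact: (uniq_prefix T_trail eT).
- exact: assigned_prefix_le eT.
- by apply: below; rewrite /i; lia.
- exact: below.
- exact: (element_fresh T_trail eT erefl).
- exact: (T_natural eT CM).
Qed.

Definition trail_point : {ffun 'I_m -> bool} :=
  [ffun i : 'I_m => (i : nat, true) \in assignment T].

Definition analysis_inv (sigma : seq lit) (C : clause) : Prop :=
  falsified_within (trail_point |: W) C \/
  [/\ core_like C, hits a_lit C & ex_falsified blocks sigma C].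

Lemma analysis_inv_weak sigma C :
  analysis_inv sigma C -> weak_clause (trail_point |: W) C.
Proof. by case=> [|[]]; [left | right]. Qed.

Lemma agrees_of_falsified (s : {ffun 'I_m -> bool}) (i : 'I_m) (l : lit) :
  neg l \in assignment T -> l.1 = i -> s i != trail_point i -> agrees s l.
Proof.
move=> nT li si; apply/existsP; exists i; apply/eqP.
have := lit_value (uniq_prefix T_trail (esym (cats0 T))) nT.
move: si; rewrite ffunE -li /=; case: l li {nT} => x b /= _.
by case: b; case: (s i); case: (_ \in _).
Qed.

(* Once no a-variable is left, the probes force every x_i into the clause, which
   therefore excludes the point of the trail only. *)
Lemma analysis_inv_red T1 T2 C : T = T1 ++ T2 -> core_like C ->
  ex_falsified blocks (assignment T1) C ->
  analysis_inv (assignment T1) (red blocks C).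
Proof.
move=> eT clC falC; have [aC|no_a] := boolP (hits a_lit C).
  by right; split; [apply: core_like_red | apply: hits_a_red
                   | apply: ex_falsified_red].
left; split=> [l|s]; first exact: red_core_like_x_vars.
rewrite !inE negb_or => /andP[sT _].
have /existsP[i si] : [exists i, s i != trail_point i].
  apply: contraNT sT => /existsPn eq_s.
  by apply/eqP/ffunP => i; apply/eqP/negPn.
have /hitsP[l lC] := core_like_probe clC (ltn_ord i).
have /negPf := (hasPn no_a) _ lC; rewrite /a_lit /probe => -> /orP[/eqP li|//].
have lU : ~~ universal blocks l.1.
  by rewrite universal_blocks li; have := ltn_ord i; lia.
apply/hitsP; exists l; first exact: mem_red_nonuniversal.
apply: agrees_of_falsified si => //.
by rewrite eT assignment_cat mem_cat falC.
Qed.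

Lemma pivot_not_x T1 e T2 p C :
  T = T1 ++ e :: T2 -> (step_element e).2 = Some p ->
  hits a_lit C -> ex_falsified blocks (rcons (assignment T1) p) C -> m <= p.1.
Proof.
move=> eT ep /hitsP[a aC am] falC; rewrite leqNgt; apply/negP => pm.
have := falC a aC (a_lit_nonuniversal am); move: am; rewrite /a_lit => am.
rewrite mem_rcons inE => /predU1P[ap|/mem_var aT1].
  by move: pm; rewrite -ap /=; lia.
by have := x_assigned_first eT ep pm aT1; rewrite /=; lia.
Qed.

Lemma x_antecedent_falsified_within T1 p A T2 :
  T = T1 ++ Propagate (Some p) A :: T2 -> p.1 < m -> falsified_within W A.
Proof.
move=> eT pm; have [_ UA] := trail_propagate T_trail eT.
case: (antecedent_weak eT) => // -[_ /hitsP[a aA am]].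
case: (unit_under_nonuniversal UA aA (a_lit_nonuniversal am)).
  move=> /mem_var/(x_assigned_first eT erefl pm).
  by move: am; rewrite /a_lit /=; lia.
by case=> ap; move: am pm; rewrite /a_lit ap; lia.
Qed.

Lemma analysis_inv_decide T1 d T2 C : T = T1 ++ Decide d :: T2 ->
  analysis_inv (rcons (assignment T1) d) C -> analysis_inv (assignment T1) C.
Proof.
move=> eT [fC|[clC aC falC]]; [by left | right; split=> //].
apply: (ex_falsified_rcons _ falC) => _; rewrite universal_blocks.
have := pivot_not_x eT erefl aC falC; have := decision_not_a eT; rewrite /a_lit.
suff : d.1 <= m.*2 by lia.
apply: assigned_le; rewrite eT assigned_cat mem_cat; apply/orP; right.
by rewrite /assigned /= inE eqxx.
Qed.

Lemma analysis_inv_propagate T1 p A T2 C :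
  T = T1 ++ Propagate (Some p) A :: T2 ->
  analysis_inv (rcons (assignment T1) p) C ->
  analysis_inv (assignment T1)
    (if neg p \in C then red blocks (resolve p C (red blocks A)) else C).
Proof.
move=> eT invC; have [_ UA] := trail_propagate T_trail eT.
have [pA pE _] := unit_under_literal UA; case: ifPn => npC; last first.
  case: invC => [fC|[clC aC falC]]; [by left | right; split=> //].
  by apply: (ex_falsified_rcons _ falC) => pC; rewrite pC in npC.
case: invC => [fC|[clC aC falC]].
  have fA : falsified_within (trail_point |: W) A.
    apply: falsified_withinS (subsetUr _ _) _.
    exact: x_antecedent_falsified_within eT (fC.1 _ npC).
  have fR := falsified_within_resolve p fC fA.
  by left; rewrite (falsified_within_red fA) (falsified_within_red fR).
have pa : a_lit p.
  have := pivot_not_x eT erefl aC falC; have := core_like_vars clC npC.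
  by move: pE; rewrite existential_blocks /a_lit /=; lia.
apply: (analysis_inv_red eT); last exact: ex_falsified_resolve UA falC.
apply: core_like_resolve => //.
case: (antecedent_weak eT) => [[/(_ _ pA)]|[clA aA]]; last exact: core_like_red.
by move: pa; rewrite /a_lit; lia.
Qed.

Lemma learn_leftwards_weak T1 T2 C D : T = T1 ++ T2 ->
  analysis_inv (assignment T1) C -> D \in learn_leftwards blocks C (rev T1) ->
  weak_clause (trail_point |: W) D.
Proof.
elim/last_ind: T1 T2 C => [|T1 e IH] T2 C //; rewrite cat_rcons rev_rcons => eT.
rewrite assignment_rcons.
case: e eT => [d|[p|] A] eT /=; rewrite ?cats1 ?cats0 => invC.
- exact: IH eT (analysis_inv_decide eT invC).
- have invC' := analysis_inv_propagate eT invC.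
  rewrite inE => /predU1P[->|]; last exact: IH eT invC'.
  exact: analysis_inv_weak invC'.
- exact: IH eT invC.
Qed.

Lemma learnable_weak D : conflicting T -> D \in learnable blocks T ->
  weak_clause (trail_point |: W) D.
Proof.
case=> T1 [A eT]; rewrite /learnable {1}eT rev_rcons.
rewrite -cats1 in eT; have [_ UA] := trail_propagate T_trail eT.
have invA : analysis_inv (assignment T1) (red blocks A).
  case: (antecedent_weak eT) => [fA|[clA _]].
    left; rewrite (falsified_within_red fA).
    exact: falsified_withinS (subsetUr _ _) fA.
  exact: analysis_inv_red eT clA (ex_falsified_conflict UA).
rewrite inE => /predU1P[->|]; first exact: analysis_inv_weak invA.
exact: learn_leftwards_weak eT invA.
Qed.

End ConflictAnalysis.

Section Refutation.

Variables (R : reduction_policy) (P : seq round).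
Hypothesis m_gt0 : 0 < m.
Hypothesis P_refutation : qcdcl_refutation R (sep_formula R m_gt0) P.

Lemma learned_weak i : i <= size P ->
  exists2 W : {set {ffun 'I_m -> bool}}, #|W| <= i &
    forall C : clause, C \in learned (take i P) -> weak_clause W C.
Proof.
elim: i => [|i IH] iP.
  by exists set0; rewrite ?cards0 // => C; rewrite take0 inE.
have [W Wi learnedW] := IH (ltnW iP).
case ir: (onth P i) => [r|]; last by move: iP; rewrite -onthTE ir.
have [trT confT [pre [L eL]] _] := P_refutation.1 _ _ ir.
exists (trail_point (round_trail r) |: W); first by rewrite cardsU1; lia.
move=> C; rewrite (take_nth r) // (onth_nth r r P i ir).
rewrite inE map_rcons mem_rcons inE; case/predU1P=> [->|CW]; last first.
  by apply: weak_clauseS (subsetUr _ _) (learnedW C _); rewrite inE.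
pose phi := sep_matrix R `|` learned (take i P).
apply: (learnable_weak (R := R) (phi := phi)) => //.
- by move=> A AM; rewrite inE AM.
- move=> A; rewrite inE => /orP[/in_sep_matrix[[h hcore ->]|]|/learnedW].
  + by left; right; split; [apply: core_like_core | apply: hits_a_core].
  + by right.
  + by left.
- move=> T1 d T2 eT A p AM.
  exact: (round_decision_not_unit P_refutation ir eT AM).
- by case/prefixP: pre => s ->; rewrite mem_cat eL mem_rcons inE eqxx.
Qed.

Lemma refutation_size_ge : 2 ^ m <= proof_size P.
Proof.
apply: leq_trans (proof_size_ge_rounds P_refutation).
have [W WP learnedW] := learned_weak (leqnn _).
case: P_refutation => _ [P' [r [eP r0]]].
have : fset0 \in learned (take (size P) P).
  by rewrite take_size inE eP map_rcons r0 mem_rcons inE eqxx.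
case/learnedW=> [[_ hits0]|[_ /hitsP[] //]].
have -> : 2 ^ m = #|[set: {ffun 'I_m -> bool}]|.
  by rewrite cardsT card_ffun card_bool card_ord.
apply: leq_trans WP; apply/subset_leq_card/subsetP => s _; apply/negPn/negP.
by move=> /hits0/hitsP[].
Qed.

End Refutation.

(** * The upper bound *)

Lemma red_w_clause : red blocks [fset (wvar, true)] = fset0.
Proof.
rewrite -[X in red _ X]fset0U.
apply: red_fsetU_trailing => [l|l]; rewrite inE // => /eqP ->.
split=> [|q]; first exact: w_universal.
by rewrite !inE => /eqP -> /existential_not_universal; rewrite w_universal.
Qed.

Lemma sep_formula_NO_RED_refutation (m_gt0 : 0 < m) :
  exists2 P, qcdcl_refutation RED (sep_formula NO_RED m_gt0) P
    & proof_size P = 1.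
Proof.
apply: (@refutation_of_natural_conflict _ _ [::] [fset (wvar, true)]) => //.
- exact: natural_prefix_nil.
- exact: w_clause_in_sep_matrix.
- exists [fset (wvar, true)]; first by apply: restrict_fresh.
  by split=> //; exact: red_w_clause.
- by rewrite /learnable /= red_w_clause inE.
Qed.

Lemma w_occurs_in_sep_matrix_RED (C : clause) : C \in sep_matrix RED ->
  exists2 l : lit, l \in C & l.1 = wvar.
Proof.
case/in_sep_matrix=> [[h _ ->]|].
  by exists (wvar, false); rewrite // !inE eqxx orbT.
by rewrite mem_seq2 => /orP[]/eqP ->; exists (wvar, true) => //;
  rewrite in_wt_clause eqxx orbT.
Qed.

Lemma not_unit_w_unassigned (C : clause) (sigma : seq lit) p :
  C \in sep_matrix RED -> wvar \notin vars sigma ->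
  ~ unit_under blocks NO_RED C sigma p.
Proof.
move=> /w_occurs_in_sep_matrix_RED[l lC lw] ws UC.
have lE : ~~ existential blocks l.1 by rewrite lw existential_blocks; lia.
case/negP: ws; rewrite -lw.
exact: mem_var (unit_under_NO_RED UC lC lE).
Qed.

Lemma not_falsified_t_unassigned (C : clause) (sigma : seq lit) :
  C \in sep_matrix RED -> (wvar, false) \in sigma -> tvar \notin vars sigma ->
  ~ unit_under blocks NO_RED C sigma None.
Proof.
move=> /in_sep_matrix[[h _ ->]|Cg] ws ts UC.
  case: UC => D /restrictP[/(_ (wvar, false)) + _] _.
  by rewrite ws !inE eqxx orbT => /(_ isT).
have [b tC] : exists b, (tvar, b) \in C.
  move: Cg; rewrite mem_seq2 => /orP[]/eqP ->; [exists true | exists false];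
    by rewrite in_wt_clause eqxx.
have tU : ~~ universal blocks (tvar, b).1 by rewrite universal_blocks /=; lia.
have [/mem_var|//] := unit_under_nonuniversal UC tC tU.
by rewrite (negPf ts).
Qed.

Definition decisions (k : nat) : trail :=
  [seq Decide (x, true) | x <- iota 0 k].

Lemma decisionsS k : decisions k.+1 = rcons (decisions k) (Decide (k, true)).
Proof. by rewrite /decisions -addn1 iotaD map_cat cats1. Qed.

Lemma assigned_decisions k : assigned (decisions k) = iota 0 k.
Proof.
by elim: k => // k IH; rewrite decisionsS assigned_rcons IH -addn1 iotaD.
Qed.

Lemma conflict_free_decisions k : ~~ conflict_in (decisions k).
Proof. by rewrite /conflict_in /elements -map_comp; apply/mapP => -[]. Qed.

Lemma natural_prefix_rcons_decide T b k :
  natural_prefix blocks NO_RED (sep_matrix RED) T ->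
  ~~ conflict_in T -> assigned T = iota 0 k -> k <= wvar ->
  natural_prefix blocks NO_RED (sep_matrix RED) (rcons T (Decide (k, b))).
Proof.
move=> natT cT eT kw; apply: natural_prefix_rcons => //; split.
- by rewrite eT mem_iota /=; lia.
- by rewrite bound_blocks /=; lia.
- by move=> C l _ _; rewrite eT mem_iota /= => kl; apply: lv_leq; lia.
- move=> C p CM; apply: not_unit_w_unassigned => //.
  by rewrite -/(assigned T) eT mem_iota; lia.
Qed.

Lemma natural_prefix_decisions k : k <= wvar ->
  natural_prefix blocks NO_RED (sep_matrix RED) (decisions k).
Proof.
elim: k => [_|k IH kw]; first exact: natural_prefix_nil.
rewrite decisionsS; apply: natural_prefix_rcons_decide (ltnW kw).
- exact: IH (ltnW kw).
- exact: conflict_free_decisions.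
- exact: assigned_decisions.
Qed.

Section WTUnits.

Variable sigma : seq lit.
Hypothesis sigma_uniq : uniq (vars sigma).
Hypothesis w_false : (wvar, false) \in sigma.

Lemma wt_clause_propagates b : tvar \notin vars sigma ->
  unit_under blocks NO_RED (wt_clause b) sigma (Some (tvar, b)).
Proof.
move=> ts; exists (clause_of_element (Some (tvar, b))).
  apply: restrict_unit => // l; rewrite in_wt_clause; last first.
    by move=> [<-]; rewrite eqxx.
  by move=> /orP[]/eqP ->; [right | left].
by split=> // l [<-]; rewrite existential_blocks eqxx !orbT.
Qed.

Lemma wt_clause_conflict b : neg (tvar, b) \in sigma ->
  unit_under blocks NO_RED (wt_clause b) sigma None.
Proof.
move=> tb; exists (clause_of_element None); last by split.
by apply: restrict_unit => // l; rewrite in_wt_clause => /orP[]/eqP ->; left.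
Qed.

End WTUnits.

Lemma resolve_wt_clause :
  resolve (tvar, true) (wt_clause false) (wt_clause true) = [fset (wvar, true)].
Proof. by apply: resolve_complementary; rewrite inE /neg xpair_eqE /=; lia. Qed.

Definition w_trail : trail := rcons (decisions wvar) (Decide (wvar, false)).

Definition wt_trail : trail :=
  rcons w_trail (Propagate (Some (tvar, true)) (wt_clause true)).

Lemma assigned_w_trail : assigned w_trail = iota 0 tvar.
Proof. by rewrite assigned_rcons assigned_decisions -[tvar]addn1 iotaD. Qed.

Lemma assigned_wt_trail : assigned wt_trail = iota 0 tvar.+1.
Proof. by rewrite assigned_rcons assigned_w_trail -[tvar.+1]addn1 iotaD. Qed.

Lemma w_false_in_w_trail : (wvar, false) \in assignment w_trail.
Proof.
by rewrite (@assignment_rcons_literal _ _ (wvar, false)) // mem_rcons mem_head.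
Qed.

Lemma conflict_free_w_trail : ~~ conflict_in w_trail.
Proof. by rewrite conflict_in_rcons; apply: conflict_free_decisions. Qed.

Lemma natural_prefix_wt_trail :
  natural_prefix blocks NO_RED (sep_matrix RED) wt_trail.
Proof.
have ts : tvar \notin vars (assignment w_trail).
  by rewrite -/(assigned w_trail) assigned_w_trail mem_iota; lia.
apply: natural_prefix_rcons conflict_free_w_trail _.
  apply: natural_prefix_rcons_decide (assigned_decisions wvar) (leqnn _).
    exact: natural_prefix_decisions.
  exact: conflict_free_decisions.
split; first exact: wt_clause_in_sep_matrix.
  apply: wt_clause_propagates w_false_in_w_trail _ ts.
  by rewrite -/(assigned w_trail) assigned_w_trail iota_uniq.
by case=> C CM /(not_falsified_t_unassigned CM w_false_in_w_trail ts).
Qed.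

Lemma sep_formula_RED_refutation (m_gt0 : 0 < m) :
  exists2 P, qcdcl_refutation NO_RED (sep_formula RED m_gt0) P
    & proof_size P = m.*2 + 4.
Proof.
have -> : m.*2 + 4 = (size wt_trail).+1.
  by rewrite !size_rcons size_map size_iota; lia.
apply: (@refutation_of_natural_conflict _ _ wt_trail (wt_clause false)).
- exact: natural_prefix_wt_trail.
- by rewrite conflict_in_rcons; apply: conflict_free_w_trail.
- exact: wt_clause_in_sep_matrix.
- apply: wt_clause_conflict.
  + by rewrite -/(assigned wt_trail) assigned_wt_trail iota_uniq.
  + by rewrite assignment_rcons mem_cat w_false_in_w_trail.
  + rewrite (@assignment_rcons_literal _ _ (tvar, true)) // mem_rcons.
    exact: mem_head.
- rewrite /learnable !rev_rcons /= !red_wt_clause in_wt_clause eqxx /=.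
  by rewrite resolve_wt_clause red_w_clause !inE eqxx orbT.
Qed.

End Formula.

Definition other_policy (R : reduction_policy) : reduction_policy :=
  if R is RED then NO_RED else RED.

Definition sep_family (R : reduction_policy) (n : nat) : qcnf :=
  sep_formula R (ltn0Sn n).

Lemma sep_family_poly R : poly_size_refutations (other_policy R) (sep_family R).
Proof.
exists ('X + 1%:P)%R => n.
have [P PR sizeP] : exists2 P,
    qcdcl_refutation (other_policy R) (sep_family R n) P &
    proof_size P <= n.+1.*2 + 4.
  case: R.
    have [P PR sizeP] := sep_formula_RED_refutation (ltn0Sn n).
    by exists P; rewrite ?sizeP.
  have [P PR sizeP] := sep_formula_NO_RED_refutation (ltn0Sn n).
  by exists P; rewrite ?sizeP ?addn4.
exists P => //; rewrite !hornerE; apply: leq_trans sizeP _.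
by have := sep_formula_size_ge R (ltn0Sn n); rewrite /sep_family; lia.
Qed.

Lemma sep_family_superpoly R : superpoly_size_refutations R (sep_family R).
Proof.
apply: superpoly_of_exp2 => [|n P /refutation_size_ge]; last first.
  by apply: leq_trans; rewrite leq_exp2l.
exists ((16%N)%:P * ('X + (3%N)%:P) * ('X + (3%N)%:P))%R => n; rewrite !hornerE.
rewrite -[leqRHS]/(16 * (n + 3) * (n + 3)) addn3 -mulnA mulnn.
exact: sep_formula_size_le.
Qed.

Theorem theorem8p4 :
  (~ simulates NO_RED RED /\ ~ simulates RED NO_RED) /\
  (exists Phi : nat -> qcnf,
     (forall n : nat, qfalse (Phi n)) /\
     poly_size_refutations RED Phi /\ superpoly_size_refutations NO_RED Phi) /\
  (exists Phi : nat -> qcnf,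
     (forall n : nat, qfalse (Phi n)) /\
     poly_size_refutations NO_RED Phi /\ superpoly_size_refutations RED Phi).
Proof.
have separation R : exists Phi : nat -> qcnf,
    (forall n : nat, qfalse (Phi n)) /\
    poly_size_refutations (other_policy R) Phi /\
    superpoly_size_refutations R Phi.
  exists (sep_family R); split; first by move=> n; apply: sep_formula_false.
  by split; [apply: sep_family_poly | apply: sep_family_superpoly].
have not_simulates R : ~ simulates R (other_policy R).
  apply: not_simulates_of_separation (sep_family_superpoly R).
  exact: sep_family_poly.
by split; [split; [apply: (not_simulates NO_RED) | apply: (not_simulates RED)]
          | split; [apply: (separation NO_RED) | apply: (separation RED)]].
Qed.
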